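(* Let $q$ be a prime power, $n$ a positive integer, $\alpha,\beta,\gamma\in\mathbb{F}_{q^n}^*$, and let $I\neq J$ be nonnegative integers with $I,J<n-1$. Assume that $\gcd(I,J,n)=1$ and that the polynomial $$P^{I,J}_{\alpha,\beta,\gamma}(X)=\begin{cases} X^{q^{J-I}+1}+\gamma X-\alpha\beta, & \text{if } I<J,\\ X^{q^{I-J}+1}+\gamma X^{q^{I-J}}-\alpha\beta, & \text{if } I>J,\end{cases}$$ has no roots in $\mathbb{F}_{q^n}$. Then $U_{\alpha,\beta,\gamma}^{I,J,n}$ is exceptional scattered; that is, $U^{(1)}$ is a scattered $\mathbb{F}_q$-subspace of $\mathbb{F}_{q^n}^4$, and $U^{(\ell)}$ is a scattered $\mathbb{F}_q$-subspace of $\mathbb{F}_{q^{\ell n}}^4$ for infinitely many positive integers $\ell$.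
   Context: For a positive integer $\ell$, set $U^{(\ell)}:=\{(x,\,y,\,x^{q^I}+\alpha y^{q^J},\,x^{q^J}+\beta y^{q^I}+\gamma y^{q^J}) : x,y\in\mathbb{F}_{q^{\ell n}}\}\subseteq \mathbb{F}_{q^{\ell n}}^4$, an $\mathbb{F}_q$-subspace of $\mathbb{F}_q$-dimension $2\ell n$; $U_{\alpha,\beta,\gamma}^{I,J,n}:=U^{(1)}$. An $\mathbb{F}_q$-subspace $U$ of $\mathbb{F}_{q^N}^k$ is called scattered if $\dim_{\mathbb{F}_q}(U\cap H)\le 1$ for every $1$-dimensional $\mathbb{F}_{q^N}$-subspace $H$ of $\mathbb{F}_{q^N}^k$. (A scattered subspace of $\mathbb{F}_{q^N}^4$ of $\mathbb{F}_q$-dimension $2N$ is called maximum scattered; each $U^{(\ell)}$ has dimension $2\ell n$.) *)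

(* Defs.v *)
From HB Require Import structures.
From mathcomp Require Import all_boot all_order all_fingroup all_algebra.
From mathcomp Require Import all_solvable all_field.

Set Implicit Arguments.
Unset Strict Implicit.
Unset Printing Implicit Defensive.

Import GRing.Theory.
Local Open Scope ring_scope.

Section Scattered.

Variables (F : finFieldType) (L : fieldExtType F).

(* L^k carries two linear structures: {ffun 'I_k -> L} is an F-space, while
   {ffun 'I_k -> L^o} is an L-space; the two types are convertible.
   restrict_scalars H is the L-subspace H seen as an F-subspace, spanned by
   the products of an F-basis of L by an L-basis of H. *)
Definition restrict_scalars k (H : {vspace {ffun 'I_k -> L^o}}) :
    {vspace {ffun 'I_k -> L}} :=
  <<[seq [ffun j => (a * (v : {ffun 'I_k -> L}) j)%R] : {ffun 'I_k -> L}
     | a <- vbasis {:L}, v <- vbasis H]>>%VS.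

Lemma mem_restrict_scalars k (H : {vspace {ffun 'I_k -> L^o}})
    (v : {ffun 'I_k -> L}) :
  (v \in restrict_scalars H) = ((v : {ffun 'I_k -> L^o}) \in H).
Proof.
pose V := {ffun 'I_k -> L}; pose W := {ffun 'I_k -> L^o}.
apply/idP/idP.
  rewrite /restrict_scalars; set s := (X in span X) => /(@coord_span _ _ _ (in_tuple s)) ->.
  apply: (@memv_suml L W) => i _.
  set w := _`_i; have /allpairsP[[a u] /= [_ Hu Dw]] : w \in s by exact: mem_nth.
  have -> : coord (in_tuple s) i v *: w
      = ((coord (in_tuple s) i v)%:A * a) *: (u : W) :> W.
    apply/ffunP=> j; rewrite Dw !ffunE -[RHS]/(_%:A * a * (u : V) j).
    by rewrite -mulrA mulr_algl.
  by apply: (@memvZ L W); rewrite vbasis_mem.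
move=> /(@coord_vbasis L W) ->; apply: (@memv_suml F V) => i _.
set c := coord _ _ _; set w := _`_i.
have -> : (c *: w : W) = \sum_(j < \dim {:L})
    coord (vbasis {:L}) j c *: [ffun l => ((vbasis {:L})`_j * (w : V) l)%R] :> V.
  apply/ffunP=> l; rewrite sum_ffunE ffunE.
  rewrite -[LHS]/((c : L) * (w : V) l) {1}(coord_vbasis (memvf (c : L))) mulr_suml.
  by apply: eq_bigr => j _; rewrite !ffunE scalerAl.
apply: memv_suml => j _; apply: memvZ; apply/memv_span/allpairsP.
exists ((vbasis {:L})`_j, w); split=> //=; first by rewrite mem_nth ?size_tuple.
by rewrite mem_nth ?size_tuple.
Qed.

Definition scattered k (U : {vspace {ffun 'I_k -> L}}) : Prop :=
  forall H : {vspace {ffun 'I_k -> L^o}},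
    \dim H = 1%N -> (\dim (U :&: restrict_scalars H) <= 1)%N.

Section U.

Variables (alpha beta gamma : L) (I J : nat).
Local Notation q := #|F|.

Definition U_vec (u : L * L) : {ffun 'I_4 -> L} :=
  let: (x, y) := u in
  [ffun i : 'I_4 => [:: x; y; x ^+ (q ^ I) + alpha * y ^+ (q ^ J);
    x ^+ (q ^ J) + beta * y ^+ (q ^ I) + gamma * y ^+ (q ^ J)]`_i].

(* linfun f is f itself as a linear map only when f is linear; U_vec_linear
   shows that it is, so that U_space is the image of U_vec. *)
Definition U_space : {vspace {ffun 'I_4 -> L}} := limg (linfun U_vec).

Lemma frob_linear m (a : F) (x y : L) :
  (a *: x + y) ^+ (q ^ m) = a *: x ^+ (q ^ m) + y ^+ (q ^ m).
Proof.
elim: m => [|m IHm]; first by rewrite expn0 !expr1.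
rewrite expnSr !exprM {}IHm.
have [p p_pr charF] := finPcharP F.
have qp : [pchar L].-nat q.
  have -> : q = (p ^ logn p q)%N by exact: (card_pprimeChar charF).
  by rewrite pnatX pnatE // pchar_lalg charF.
by rewrite exprDn_pchar // -mulr_algl exprMn -[a%:A]/(in_alg L a) -rmorphXn expf_card /= mulr_algl.
Qed.

Lemma U_vec_linear : linear U_vec.
Proof.
move=> a [x1 y1] [x2 y2]; apply/ffunP=> i; rewrite /= !ffunE !frob_linear.
case: i => -[|[|[|[|//]]]] _ //=.
  by rewrite mulrDr !scalerDr -scalerAr addrACA.
by rewrite !mulrDr !scalerDr -!scalerAr !(addrACA _ (_ *: _)) !(addrACA _ _ (_ *: _)).
Qed.

HB.instance Definition _ :=
  GRing.isLinear.Build F (L * L)%type {ffun 'I_4 -> L} _ U_vec U_vec_linear.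

Lemma mem_U_space v :
  reflect (exists x y, v = U_vec (x, y)) (v \in U_space).
Proof.
apply: (iffP memv_imgP) => [[[x y] _ ->]|[x [y ->]]].
  by exists x, y; rewrite lfunE.
by exists (x, y); rewrite ?memvf ?lfunE.
Qed.

Lemma dim_U_space : \dim U_space = (2 * \dim {:L})%N.
Proof.
rewrite /U_space limg_dim_eq; first by rewrite !dimvf mul2n -addnn.
apply/eqP; rewrite -subv0; apply/subvP=> -[x y]; rewrite memv_cap memv_ker memvf lfunE /=.
move=> /eqP/ffunP Dv; rewrite memv0.
have := Dv 0; have := Dv 1; rewrite !ffunE /= => -> ->; exact: eqxx.
Qed.

End U.

End Scattered.

Definition P_poly (R : nzRingType) (q I J : nat) (alpha beta gamma : R) :
    {poly R} :=
  if (I < J)%N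
  then 'X^(q ^ (J - I) + 1) + gamma *: 'X - (alpha * beta)%:P
  else 'X^(q ^ (I - J) + 1) + gamma *: 'X^(q ^ (I - J)) - (alpha * beta)%:P.

Lemma finField_extension (K : finFieldType) (ell : nat) :
  (0 < ell)%N -> exists L : fieldExtType K, \dim {:L} = ell.
Proof.
move=> ell_gt0; have K_gt1 := finNzRing_gt1 K; pose m := (#|K| ^ ell)%N.
have m_gt1 : (1 < m)%N by rewrite -(exp1n ell) ltn_exp2r.
have m1_gt0 : (0 < m.-1)%N by rewrite -ltnS prednK // ltnW.
pose Q (R : nzRingType) : {poly R} := 'X^m - 'X.
have DQ (R : nzRingType) : Q R = ('X^(m.-1) - 1) * ('X - 0).
  by rewrite subr0 mulrBl mul1r -exprSr prednK // ltnW.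
have /FinSplittingFieldFor[/= L splitL] : Q K != 0.
  by rewrite DQ monic_neq0 ?rpredM ?monicXsubC ?monicXnsubC.
rewrite rmorphB rmorphXn /= map_polyX -/(Q L) in splitL.
have [p p_pr charK] := finPcharP K.
have mL0 : m%:R = 0 :> L.
  have cK : #|K| = (p ^ logn p #|K|)%N by exact: (card_pprimeChar charK).
  have charL : p \in [pchar L] by rewrite pchar_lalg.
  rewrite /m cK -expnM natrX pcharf0 // expr0n muln_eq0 !gtn_eqF //.
  by rewrite lt0n; apply: contraL K_gt1 => /eqP e0; rewrite cK e0.
pose Lm := FinFieldExtType L.
have /finField_galois_generator[/= a _ Da] : (1 <= {:L})%VS by apply: sub1v.
pose Em := fixedSpace (a ^+ ell)%g; rewrite dimv1 expn1 in Da.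
have {splitL} [zs DQL defL] := splitL.
have Uzs : uniq zs.
  rewrite -separable_prod_XsubC -(eqp_separable DQL) DQ separable_root andbC.
  rewrite /root !hornerE subr_eq0 eq_sym expr0n gtn_eqF ?oner_eq0 //=.
  rewrite cyclotomic.separable_Xn_sub_1 // -subn1 natrB ?subr_eq0 ?(ltnW m_gt1) //.
  by rewrite mL0 eq_sym oner_eq0.
exists L.
have in_zs : zs =i Em.
  move=> z; rewrite -root_prod_XsubC -(eqp_root DQL) (sameP fixedSpaceP eqP).
  rewrite /root !hornerE subr_eq0 /= /m; congr (_ == z).
  elim: (ell) => [|i IHi]; first by rewrite gal_id.
  by rewrite expgSr expnSr exprM IHi galM ?Da ?memvf.
have defEm : Em = {:L}%VS.
  apply/eqP; rewrite eqEsubv subvf -defL -[Em]subfield_closed agenvS //.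
  by rewrite subv_add sub1v; apply/span_subvP=> z; rewrite in_zs.
have cL : #|Lm| = m.
  have /eq_card -> : Lm =i zs by move=> z; rewrite in_zs defEm memvf.
  apply: succn_inj; rewrite (card_uniqP _) //= -(size_prod_XsubC _ id).
  by rewrite -(eqp_size DQL) size_polyDl size_polyXn // size_polyN size_polyX.
apply/eqP; rewrite -(eqn_exp2l _ _ K_gt1) -/m -cL.
apply/eqP; rewrite -[RHS](@card_vspacef K (finvect_type L) (Vector.class (finvect_type L))).
by rewrite (@card_vspace K (finvect_type L) (Vector.class (finvect_type L))).
Qed.

Lemma extension_exists (F : finFieldType) (K : fieldExtType F) (ell : nat) :
  (0 < ell)%N ->
  exists (L : fieldExtType F) (_ : {lrmorphism K -> L}),
    \dim {:L} = (ell * \dim {:K})%N.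
Proof.
case/(finField_extension (FinFieldExtType K)) => E dimE.
pose K' : fieldExtType F := K; pose E' : fieldExtType K' := E.
pose f : K' -> baseFieldType E' := fun a => a%:A.
have f_lin : linear f.
  move=> a x y; rewrite /f baseField_scaleE scalerDl; congr (_ + _).
  by rewrite scalerA mulr_algl.
have f_mon : monoid_morphism f by split; [exact: (rmorph1 (in_alg E')) | exact: (rmorphM (in_alg E'))].
pose fL := GRing.isLinear.Build F K' (baseFieldType E') _ f f_lin.
pose fM := GRing.isMonoidMorphism.Build K' (baseFieldType E') f f_mon.
pose iota : {lrmorphism K' -> baseFieldType E'} := HB.pack f fL fM.
exists (baseFieldType E'), iota.
have -> : fullv = baseVspace {:E'}.
  apply/vspaceP=> x; rewrite memvf; symmetry.
  by have -> := mem_baseVspace {:E'} x; exact: (@memvf K' E').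
by rewrite dim_baseVspace; congr (_ * _)%N.
Qed.

(* The field with q^(ell n) elements is any extension L of K of degree ell; such
   extensions are isomorphic over K, and extension_exists provides one for each
   ell > 0, so the quantification over L is not vacuous. *)
Definition U_scattered_in_degree (F : finFieldType) (K : fieldExtType F)
    (alpha beta gamma : K) (I J ell : nat) : Prop :=
  forall (L : fieldExtType F) (iota : {lrmorphism K -> L}),
    \dim {:L} = (ell * \dim {:K})%N ->
    scattered (U_space (iota alpha) (iota beta) (iota gamma) I J).

Definition U_exceptional_scattered (F : finFieldType) (K : fieldExtType F)
    (alpha beta gamma : K) (I J : nat) : Prop :=
  scattered (U_space alpha beta gamma I J) /\
  forall m : nat, exists2 ell, (m < ell)%N &
    U_scattered_in_degree alpha beta gamma I J ell.

(* Main.v *)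
Require Import Defs.
From HB Require Import structures.
From mathcomp Require Import all_boot all_order all_fingroup all_algebra.
From mathcomp Require Import all_solvable all_field ring.

Set Implicit Arguments.
Unset Strict Implicit.
Unset Printing Implicit Defensive.

Import GRing.Theory.
Local Open Scope ring_scope.

(** If [u] is the vector of [U] with parameters [(x, y)] and [lambda u] is again
    in [U], then [A = lambda^(q^I) - lambda] and [B = lambda^(q^J) - lambda]
    satisfy
      [A x^(q^I) = - alpha B y^(q^J)] and
      [B (x^(q^J) + gamma y^(q^J)) = - beta A y^(q^I)].
    If [A B <> 0], multiplying the two shows that [(x / y)^(q^(min I J))] is a
    root of [P]; otherwise [A = B = 0], and [lambda] lies in [F_q] because [I],
    [J] and the degree of the field are coprime.  So [U] is scattered over every
    extension in which [P] has no root and whose degree is prime to [gcd(I, J)].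
    Both conditions persist in extensions of large prime degree [l], since the
    Frobenius orbit of a new root would have [l] elements, more than [deg P]. *)

Lemma iter_period (T : Type) (f : T -> T) m x k :
  iter m f x = x -> iter (k * m) f x = x.
Proof. by move=> fx; elim: k => // k IHk; rewrite mulSn iterD IHk. Qed.

(** By Bezout, some multiple of [m] is a multiple of [n] plus the gcd, and both multiples are
    periods of [x]. *)
Lemma iter_gcdn (T : Type) (f : T -> T) m n x :
  iter m f x = x -> iter n f x = x -> iter (gcdn m n) f x = x.
Proof.
move=> fm fn; have [->|m_gt0] := posnP m; first by rewrite gcd0n.
case: (egcdnP n m_gt0) => km kn Dm _.
by rewrite -[RHS](iter_period km fm) Dm addnC iterD (iter_period kn fn).
Qed.

(** A repetition among the first [l] iterates yields a period smaller than [l], hence prime to [l],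
    and the gcd of the two periods is 1. *)
Lemma iter_prime_period (T : eqType) (f : T -> T) (l : nat) x :
  prime l -> iter l f x = x -> uniq (traject f x l) || (f x == x).
Proof.
move=> l_pr fl; apply/orP; case: (boolP (uniq _)) => [|/(uniqPn x)]; first by left.
case=> i [j []]; rewrite size_traject => ltij ltjl.
rewrite !nth_traject // ?(ltn_trans ltij) // => eq_ij; right.
have fji : iter (j - i) f x = x.
  (* Applying [f] another [l - i] times brings the [i]-th iterate back to [x]. *)
  have := congr1 (iter (l - i) f) eq_ij; rewrite -!iterD subnK ?fl; last first.
    exact/ltnW/(ltn_trans ltij).
  have -> : (l - i + j = (j - i) + l)%N.
    by rewrite addnC addnBA 1?addnBAC // ltnW // (ltn_trans ltij).
  by rewrite iterD fl => /esym.
have := iter_gcdn fl fji; suff -> : gcdn l (j - i) = 1%N by move=> /= ->.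
apply/eqP; rewrite -[_ == _]/(coprime _ _) prime_coprime // gtnNdvd ?subn_gt0 //.
exact: leq_ltn_trans (leq_subr _ _) ltjl.
Qed.

(** Makes powers with exponent [q ^ m] iterates, so that the lemmas on periods apply to Frobenius
    maps. *)
Lemma iter_expr (R : pzSemiRingType) q m (x : R) :
  iter m (fun y => y ^+ q) x = x ^+ (q ^ m).
Proof. by elim: m => //= m ->; rewrite -exprM expnSr. Qed.

Section Frobenius.

Variables (F : finFieldType) (L : fieldExtType F).
Local Notation q := #|F|.

Lemma frobD m (x y : L) : (x + y) ^+ (q ^ m) = x ^+ (q ^ m) + y ^+ (q ^ m).
Proof. by have := frob_linear m 1 x y; rewrite !scale1r. Qed.

Lemma frob0 m : 0 ^+ (q ^ m) = 0 :> L.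
Proof. by rewrite expr0n expn_eq0 -leqn0 leqNgt (ltnW (finNzRing_gt1 F)). Qed.

Lemma frob_root m (p : {poly L}) (x : L) :
  (forall i, p`_i ^+ (q ^ m) = p`_i) -> root p x -> root p (x ^+ (q ^ m)).
Proof.
move=> fix_p /rootP px0; apply/rootP.
rewrite -[RHS](frob0 m) -px0 !horner_coef (big_morph _ (frobD m) (frob0 m)).
by apply: eq_bigr => i _; rewrite exprMn fix_p exprAC.
Qed.

(** The degree of [L] is a third Frobenius period of [x]; the three have gcd 1, so [x ^+ q = x],
    which characterizes [F]. *)
Lemma frob_fixed_scalar a b (x : L) :
  x ^+ (q ^ a) = x -> x ^+ (q ^ b) = x -> coprime (gcdn a b) (\dim {:L}) ->
  exists c : F, x = c%:A.
Proof.
move=> xa xb /eqP gcd1; apply/vlineP; rewrite Fermat's_little_theorem /= dimv1.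
have /eqP xL : x ^+ (q ^ \dim {:L}) == x.
  by rewrite -(Fermat's_little_theorem {:L}) memvf.
rewrite -[1%R : nat]gcd1 -iter_expr; apply/eqP.
by apply: iter_gcdn; [apply: iter_gcdn|]; rewrite iter_expr.
Qed.

End Frobenius.

Lemma no_new_root (F : finFieldType) (K L : fieldExtType F)
    (iota : {lrmorphism K -> L}) (l : nat) (p : {poly K}) :
    prime l -> (size p <= l)%N -> \dim {:L} = (l * \dim {:K})%N ->
  (forall x : K, ~~ root p x) -> forall x : L, ~~ root (map_poly iota p) x.
Proof.
move=> l_pr le_pl dimL noroot x; apply/negP => px.
have p_neq0 : p != 0 by apply: contraNneq (noroot 0) => ->; rewrite root0.
pose Q := (#|F| ^ \dim {:K})%N; pose f (y : L) := y ^+ Q.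
have fix_iota a : iota a ^+ Q = iota a.
  rewrite -rmorphXn; congr (iota _); apply/eqP.
  by rewrite -Fermat's_little_theorem memvf.
have f_l : iter l f x = x.
  rewrite iter_expr -expnM mulnC -dimL.
  by apply/eqP; rewrite -(Fermat's_little_theorem {:L}) memvf.
have f_root i : root (map_poly iota p) (iter i f x).
  elim: i => //= i; apply: frob_root => j; rewrite coef_map; exact: fix_iota.
(* An orbit of [l] distinct roots would exceed the degree of [p], so [x] is fixed by [f]. *)
have /orP[uniq_x|/eqP fx] := iter_prime_period l_pr f_l.
  have roots_x : all (root (map_poly iota p)) (traject f x l).
    by apply/allP => _ /trajectP[i _ ->].
  have := max_poly_roots _ roots_x uniq_x.
  by rewrite map_poly_eq0 size_traject size_map_poly ltnNge le_pl => /(_ p_neq0).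
(* The image of [K] is the subfield with [Q] elements, that is, the fixed points of [f]; hence [x]
   comes from a root in [K]. *)
pose phi := linfun_ahom iota.
have dim_phi : \dim (phi @: {:K}) = \dim {:K}.
  apply: limg_dim_eq; apply/eqP; rewrite -subv0; apply/subvP => z.
  by rewrite memv_cap memv_ker memvf lfunE memv0 /= fmorph_eq0.
have : x \in (phi @: {:K})%AS by rewrite Fermat's_little_theorem /= dim_phi; apply/eqP.
case/memv_imgP => z _; rewrite lfunE /= => Dx.
by move: px; rewrite Dx fmorph_root; apply/negP/noroot.
Qed.

Lemma map_P_poly (R S : nzRingType) (f : {rmorphism R -> S}) q I J
    (alpha beta gamma : R) :
  map_poly f (P_poly q I J alpha beta gamma)
    = P_poly q I J (f alpha) (f beta) (f gamma).
Proof.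
rewrite /P_poly; case: ifP => _;
  by rewrite rmorphB rmorphD /= map_polyZ !map_polyXn ?map_polyX map_polyC /=
    (rmorphM f).
Qed.

(** With [t = x / y], division by the powers of [y] gives [t^(q^I) (t^(q^J) + gamma) = alpha beta].
    Taking the lower of the two powers of [t] as the variable turns this into [P = 0]. *)
Lemma P_poly_ratio_root (L : fieldType) q I J (alpha beta gamma x y : L) :
    y != 0 ->
    x ^+ (q ^ I) * (x ^+ (q ^ J) + gamma * y ^+ (q ^ J))
      = alpha * beta * y ^+ (q ^ I) * y ^+ (q ^ J) ->
  root (P_poly q I J alpha beta gamma) ((x / y) ^+ (q ^ minn I J)).
Proof.
move=> y_neq0 eq_xy.
have {eq_xy} : (x / y) ^+ (q ^ I) * ((x / y) ^+ (q ^ J) + gamma) = alpha * beta.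
  apply: (mulIf (expf_neq0 (q ^ I) y_neq0)); apply: (mulIf (expf_neq0 (q ^ J) y_neq0)).
  rewrite -eq_xy -[x in RHS](divfK y_neq0); move: (x / y) => t; rewrite !exprMn.
  by move: (t ^+ _) (t ^+ _) (y ^+ _) (y ^+ _) => *; ring.
move=> eq_t; rewrite /P_poly /root; case: ltnP => [ltIJ | leJI].
  have eJ : ((x / y) ^+ (q ^ I)) ^+ (q ^ (J - I)) = (x / y) ^+ (q ^ J).
    by rewrite -exprM -expnD subnKC // ltnW.
  rewrite !hornerE exprD expr1 eJ subr_eq0 -eq_t.
  by rewrite mulrDr [gamma * _]mulrC [X in X + _]mulrC.
have eI : ((x / y) ^+ (q ^ J)) ^+ (q ^ (I - J)) = (x / y) ^+ (q ^ I).
  by rewrite -exprM -expnD subnKC.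
rewrite !hornerE exprD expr1 eI subr_eq0 -eq_t.
by rewrite mulrDr [gamma * _]mulrC.
Qed.

(** Any nonzero [u] in the intersection spans [H] over [L], so the intersection lies in the [F]-line
    of [u] once all ratios are in [F]. *)
Lemma scattered_proportional (F : finFieldType) (L : fieldExtType F) k
    (U : {vspace {ffun 'I_k -> L}}) :
    (forall (u v : {ffun 'I_k -> L}) (a : L), u \in U -> v \in U -> u != 0 ->
      (forall i, v i = a * u i) -> exists c : F, a = c%:A) ->
  scattered U.
Proof.
move=> propU H dimH; set W := (_ :&: _)%VS.
have [W0|W_neq0] := eqVneq W 0%VS; first by rewrite W0 dimv0.
pose u := vpick W; have u_neq0 : u != 0 by rewrite vpick0.
have := memv_pick W; rewrite -/u memv_cap mem_restrict_scalars => /andP[Uu Hu].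
have defH : H = <[u : {ffun 'I_k -> L^o}]>%VS.
  by apply/esym/eqP; rewrite eqEdim -memvE Hu dim_vline dimH u_neq0.
suff sWu : (W <= <[u]>)%VS by rewrite (leq_trans (dimvS sWu)) // dim_vline leq_b1.
apply/subvP=> v; rewrite memv_cap mem_restrict_scalars defH => /andP[Uv /vlineP[a Dv]].
have Dvi i : v i = (a : L) * u i by rewrite Dv ffunE.
have [c Da] := propU u v a Uu Uv u_neq0 Dvi.
by apply/vlineP; exists c; apply/ffunP=> i; rewrite Dvi ffunE Da mulr_algl.
Qed.

Lemma U_space_scattered (F : finFieldType) (L : fieldExtType F)
    (alpha beta gamma : L) (I J : nat) :
    alpha != 0 -> beta != 0 -> coprime (gcdn I J) (\dim {:L}) ->
    (forall x : L, ~~ root (P_poly #|F| I J alpha beta gamma) x) ->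
  scattered (U_space alpha beta gamma I J).
Proof.
move=> alpha_neq0 beta_neq0 coIJ noroot; apply: scattered_proportional.
move=> _ _ a /mem_U_space[x [y ->]] /mem_U_space[x' [y' ->]] u_neq0 Dv.
have Dx : x' = a * x by have := Dv (inord 0); rewrite !ffunE inordK.
have Dy : y' = a * y by have := Dv (inord 1); rewrite !ffunE inordK.
have := Dv (inord 2); have := Dv (inord 3).
rewrite !ffunE !inordK //= Dx Dy !exprMn.
set A := a ^+ (#|F| ^ I); set B := a ^+ (#|F| ^ J).
move=> eq3 eq2 {Dv Dx Dy x' y'}.
have {eq2} eqA : (A - a) * x ^+ (#|F| ^ I) = - (alpha * (B - a) * y ^+ (#|F| ^ J)).
  (* Once 0 is replaced by the difference of the sides of [eq2], a ring identity remains. *)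
  by apply/subr0_eq; move/eqP: eq2; rewrite -subr_eq0 => /eqP <-; ring.
have {eq3} eqB : (B - a) * (x ^+ (#|F| ^ J) + gamma * y ^+ (#|F| ^ J))
    = - (beta * (A - a) * y ^+ (#|F| ^ I)).
  by apply/subr0_eq; move/eqP: eq3; rewrite -subr_eq0 => /eqP <-; ring.
have xy_neq0 : (x != 0) || (y != 0).
  apply: contraNT u_neq0; rewrite negb_or !negbK => /andP[/eqP-> /eqP->].
  by rewrite (_ : (0, 0) = 0) // raddf0.
(* If exactly one of [A - a] and [B - a] vanishes, the two equations force [x = y = 0]. *)
have [A0|A_neq0] := eqVneq (A - a) 0; have [B0|B_neq0] := eqVneq (B - a) 0.
- by apply: frob_fixed_scalar coIJ; apply: subr0_eq.
- move: xy_neq0 eqA eqB; rewrite A0 mulr0 !mul0r oppr0 => xy_neq0 /esym/eqP.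
  rewrite oppr_eq0 !mulf_eq0 (negPf alpha_neq0) (negPf B_neq0) expf_eq0.
  case/andP=> _ /eqP y0; move: xy_neq0; rewrite y0 eqxx orbF => x_neq0 /eqP.
  by rewrite frob0 mulr0 addr0 mulf_eq0 (negPf B_neq0) expf_eq0 (negPf x_neq0)
    andbF.
- move: xy_neq0 eqA eqB; rewrite B0 mulr0 !mul0r oppr0 => xy_neq0 /eqP.
  rewrite !mulf_eq0 (negPf A_neq0) expf_eq0.
  case/andP=> _ /eqP x0; move: xy_neq0; rewrite x0 eqxx => y_neq0 /esym/eqP.
  by rewrite oppr_eq0 !mulf_eq0 (negPf A_neq0) (negPf beta_neq0) expf_eq0
    (negPf y_neq0) andbF.
have y_neq0 : y != 0.
  apply: contraTneq xy_neq0 => y0; move/eqP: eqA.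
  rewrite y0 frob0 mulr0 oppr0 mulf_eq0 (negPf A_neq0) expf_eq0 => /andP[_ /eqP->].
  by rewrite eqxx.
case/negP: (noroot ((x / y) ^+ (#|F| ^ minn I J))); apply: P_poly_ratio_root => //.
(* Up to the nonzero factor [(A - a) (B - a)], the goal is the product of [eqA] and [eqB]. *)
apply: (mulfI A_neq0); apply: (mulfI B_neq0).
transitivity ((A - a) * x ^+ (#|F| ^ I) *
    ((B - a) * (x ^+ (#|F| ^ J) + gamma * y ^+ (#|F| ^ J)))).
  by ring.
by rewrite eqA eqB; ring.
Qed.

Theorem theorem4p2 (q n : nat) (F : finFieldType) (K : fieldExtType F)
    (alpha beta gamma : K) (I J : nat)
    (card_F : #|F| = q) (n_gt0 : (0 < n)%N) (dim_K : \dim {:K} = n)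
    (alpha_neq0 : alpha != 0) (beta_neq0 : beta != 0) (gamma_neq0 : gamma != 0)
    (neq_IJ : I != J) (ltIn : (I < n - 1)%N) (ltJn : (J < n - 1)%N)
    (gcd_IJn : gcdn (gcdn I J) n = 1%N)
    (P_noroot : forall x : K, ~~ root (P_poly q I J alpha beta gamma) x) :
  U_exceptional_scattered alpha beta gamma I J.
Proof.
subst q n; split; first by apply: U_space_scattered => //; apply/eqP.
(* The bound [m] gives infinitely many degrees, the size of [P] excludes new roots, and [I + J]
   bounds [gcdn I J], so that [l] is prime to it. *)
move=> m; have [l lt_l l_pr] :=
  prime_above (m + (size (P_poly #|F| I J alpha beta gamma) + (I + J))).
exists l => [|L iota dimL]; first exact: leq_ltn_trans (leq_addr _ _) lt_l.
(* As [I != J], they are not both 0; a zero gcd would be divisible by [l]. *)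
have gcd_gt0 : (0 < gcdn I J)%N.
  by rewrite gcdn_gt0 !lt0n -negb_and; apply: contra neq_IJ => /andP[/eqP-> /eqP->].
have le_gcd : (gcdn I J <= I + J)%N.
  apply: dvdn_leq; last by rewrite dvdn_add ?dvdn_gcdl ?dvdn_gcdr.
  by move: gcd_gt0; rewrite gcdn_gt0 addn_gt0.
apply: U_space_scattered; rewrite ?fmorph_eq0 //.
  rewrite dimL coprimeMr; apply/andP; split; last exact/eqP.
  rewrite coprime_sym prime_coprime // gtnNdvd // (leq_ltn_trans le_gcd) //.
  by apply: leq_ltn_trans lt_l; rewrite addnA leq_addl.
move=> x; rewrite -map_P_poly; apply: no_new_root dimL P_noroot x => //.
by apply/ltnW/(leq_ltn_trans _ lt_l); rewrite addnCA leq_addr.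
Qed.
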